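(* Let $M=\boldsymbol{X}(U)\subset\mathbb{R}^4_1$ be a spacelike surface with a future directed normal frame $(\boldsymbol{n}^T,\boldsymbol{n}^S)$, and let $p=\boldsymbol{X}(u)\in M$. The following conditions are equivalent: (1) $H_\ell(\boldsymbol{n}^T,\boldsymbol{n}^S)(p)=0$ or $H_\ell(\boldsymbol{n}^T,-\boldsymbol{n}^S)(p)=0$. (2) The mean curvature vector $\mathfrak{H}(p)$ is an isotropic vector, i.e. it is either the zero vector or a lightlike vector.
   Context: $\mathbb{R}^4_1$ is $\mathbb{R}^4$ with the pseudo scalar product $\langle \boldsymbol{x},\boldsymbol{y}\rangle_1=-x_0y_0+x_1y_1+x_2y_2+x_3y_3$. A nonzero vector $\boldsymbol{x}$ is spacelike, timelike or lightlike if $\langle \boldsymbol{x},\boldsymbol{x}\rangle_1$ is $>0$, $<0$ or $=0$ respectively. Let $\boldsymbol{e}_0=(1,0,0,0)$ and $\|\boldsymbol{x}\|_1=\sqrt{|\langle\boldsymbol{x},\boldsymbol{x}\rangle_1|}$. The wedge product $\boldsymbol{x}_1\wedge\boldsymbol{x}_2\wedge\boldsymbol{x}_3$ is the vector determined by $\langle\boldsymbol{x},\boldsymbol{x}_1\wedge\boldsymbol{x}_2\wedge\boldsymbol{x}_3\rangle_1=\det(\boldsymbol{x},\boldsymbol{x}_1,\boldsymbol{x}_2,\boldsymbol{x}_3)$ for all $\boldsymbol{x}$. A spacelike surface is $M=\boldsymbol{X}(U)$, where $U\subset\mathbb{R}^2$ is open and $\boldsymbol{X}:U\to\mathbb{R}^4_1$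 is a smooth embedding all of whose tangent planes $T_pM$ consist (apart from $0$) of spacelike vectors; $M$ is identified with $U$ via $\boldsymbol{X}$. A future directed normal frame is a pair $(\boldsymbol{n}^T,\boldsymbol{n}^S)$ of smooth normal fields along $M$ where $\boldsymbol{n}^T$ is unit timelike ($\langle\boldsymbol{n}^T,\boldsymbol{n}^T\rangle_1=-1$), future directed ($\langle\boldsymbol{n}^T,\boldsymbol{e}_0\rangle_1<0$), and $\boldsymbol{n}^S=\dfrac{\boldsymbol{n}^T\wedge\boldsymbol{X}_{u_1}\wedge\boldsymbol{X}_{u_2}}{\|\boldsymbol{n}^T\wedge\boldsymbol{X}_{u_1}\wedge\boldsymbol{X}_{u_2}\|_1}$; thus $\langle\boldsymbol{n}^S,\boldsymbol{n}^S\rangle_1=1$ and $\langle\boldsymbol{n}^T,\boldsymbol{n}^S\rangle_1=0$. Let $\pi^t:T_p\mathbb{R}^4_1=T_pM\oplus N_p(M)\to T_pM$ be the orthogonal projection. Shape operators on $T_pM$: $S_p(\boldsymbol{n}^T)=-\pi^t\circ d_p\boldsymbol{n}^T$, $S_p(\boldsymbol{n}^S)=-\pi^t\circ d_p\boldsymbol{n}^S$, $S_p(\boldsymbol{n}^T,\pm\boldsymbol{n}^S)=-\pi^t\circ d_p(\boldsymbol{n}^T\pm\boldsymbol{n}^S)$. The lightcone mean curvatures are $H_\ell(\boldsymbol{n}^T,\pm\boldsymbol{n}^S)(p)=\frac12\mathrm{Trace}\,S_p(\boldsymbol{n}^T,\pm\boldsymbol{n}^S)$. The mean curvature vector is $\mathfrak{H}(p)=\frac12\mathrm{Trace}\,S_p(\boldsymbol{n}^T)\,\boldsymbol{n}^T(u)+\frac12\mathrm{Trace}\,S_p(\boldsymbol{n}^S)\,\boldsymbol{n}^S(u)$.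 *)

(* Defs.v *)
From HB Require Import structures.
From mathcomp Require Import all_boot all_order all_algebra.
From mathcomp Require Import all_classical all_reals all_analysis.
From mathcomp Require Import ring.

Set Implicit Arguments.
Unset Strict Implicit.
Unset Printing Implicit Defensive.

Import Order.TTheory GRing.Theory Num.Theory.
Import numFieldNormedType.Exports.

Local Open Scope classical_set_scope.
Local Open Scope ring_scope.

Section Minkowski.
Variable R : realType.
Implicit Types x y z w : 'rV[R]_4.

(* The codomain is R^o so that [mink x] can be a linear map between R-modules. *)
Definition mink x y : R^o :=
  - (x 0 0 * y 0 0) + x 0 1 * y 0 1 + x 0 2 * y 0 2 + x 0 3 * y 0 3.

Lemma mink_is_linear x : linear (mink x).
Proof. by move=> a y z; rewrite /mink !mxE /GRing.scale /=; ring. Qed.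

HB.instance Definition _ x :=
  GRing.isLinear.Build R 'rV[R]_4 R^o *:%R (mink x) (mink_is_linear x).

Lemma minkC x y : mink x y = mink y x.
Proof. by rewrite /mink; ring. Qed.

Definition spacelike x := x != 0 /\ 0 < mink x x.
Definition lightlike x := x != 0 /\ mink x x = 0.
Definition isotropic x := x = 0 \/ lightlike x.

Definition mink_norm x : R := Num.sqrt `|mink x x|.

Definition e0 : 'rV[R]_4 := delta_mx 0 0.

Definition det4 (x x1 x2 x3 : 'rV[R]_4) : R :=
  \det (\matrix_(i < 4) [:: x; x1; x2; x3]`_i).

(* The unique vector with this property, see [wedgeP] and [wedge_unique]. *)
Definition wedge (x1 x2 x3 : 'rV[R]_4) : 'rV[R]_4 :=
  xget 0 [set w | forall x, mink x w = det4 x x1 x2 x3].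

Lemma wedgeP x1 x2 x3 x : mink x (wedge x1 x2 x3) = det4 x x1 x2 x3.
Proof.
rewrite /wedge; case: xgetP => [w _ Hw|/(_ _) Hno]; first exact: Hw.
pose c j := cofactor (\matrix_(i < 4) [:: 0; x1; x2; x3]`_i) 0 j.
exfalso; apply: (Hno (\row_j (if j == 0 then - c j else c j))) => {}x.
rewrite /det4 (expand_det_row _ 0).
have E j : cofactor (\matrix_(i < 4) [:: x; x1; x2; x3]`_i) 0 j = c j.
  rewrite /c /cofactor; congr (_ * \det _); apply/matrixP => a b.
  by rewrite !mxE.
under eq_bigr do rewrite E mxE /=.
have o1 : lift ord0 ord0 = 1 :> 'I_4 by apply/val_inj.
have o2 : lift ord0 (lift ord0 ord0) = 2 :> 'I_4 by apply/val_inj.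
have o3 : lift ord0 (lift ord0 (lift ord0 ord0)) = 3 :> 'I_4 by apply/val_inj.
rewrite !big_ord_recl big_ord0 o1 o2 o3 /mink !mxE /=; ring.
Qed.

Lemma wedge_unique x1 x2 x3 w :
  (forall x, mink x w = det4 x x1 x2 x3) -> w = wedge x1 x2 x3.
Proof.
move=> Hw; apply/rowP => j.
have Ew x : mink x w = mink x (wedge x1 x2 x3) by rewrite wedgeP Hw.
have := Ew (delta_mx 0 j); rewrite /mink !mxE.
case: j => -[|[|[|[|//]]]] jlt /=; rewrite !(mul0r, mul1r, addr0, add0r, oppr0).
- by move=> /oppr_inj; rewrite (_ : Ordinal jlt = 0) //; exact/val_inj.
- by rewrite (_ : Ordinal jlt = 1) //; exact/val_inj.
- by rewrite (_ : Ordinal jlt = 2) //; exact/val_inj.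
- by rewrite (_ : Ordinal jlt = 3) //; exact/val_inj.
Qed.

Definition orthov (V : {vspace 'rV[R]_4}) : {vspace 'rV[R]_4} :=
  (\bigcap_(i < \dim V) lker (linfun (mink (vbasis V)`_i)))%VS.

Lemma orthovP (V : {vspace 'rV[R]_4}) w :
  reflect (forall v, v \in V -> mink v w = 0) (w \in orthov V).
Proof.
rewrite /orthov memvE; apply: (iffP subv_bigcapP) => [h v /coord_vbasis -> | h i _].
  rewrite minkC linear_sum big1 // => i _; rewrite linearZ /= minkC.
  by have := h i isT; rewrite -memvE memv_ker lfunE /= => /eqP ->; rewrite scaler0.
rewrite -memvE memv_ker lfunE /= h // vbasis_mem //.
by apply: mem_nth; rewrite size_tuple.
Qed.

End Minkowski.

Definition lftrace (K : fieldType) (vT : vectType K) (f : 'End(vT)) : K :=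
  \tr (passmx.mxof (vbasis {:vT}) (vbasis {:vT}) f).

Section Smooth.
Variables (R : realType) (m n : nat).
Implicit Types f : 'rV[R]_m.+1 -> 'rV[R]_n.+1.

Definition partial (i : 'I_m.+1) f : 'rV[R]_m.+1 -> 'rV[R]_n.+1 :=
  fun u => 'D_(delta_mx 0 i) f u.

(* C^oo on an open set: f and all its iterated partial derivatives are
   (Frechet) differentiable at every point of the set. *)
Definition smooth_on (U : set 'rV[R]_m.+1) f :=
  forall (s : seq 'I_m.+1) u, U u -> differentiable (foldr partial f s) u.

Definition embedding_on (U : set 'rV[R]_m.+1) f :=
  [/\ smooth_on U f,
      forall u, U u -> injective ('d f u)
    & exists2 g : 'rV[R]_n.+1 -> 'rV[R]_m.+1,
        forall u, U u -> g (f u) = u & {within f @` U, continuous g}].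

End Smooth.

Section Surface.
Variable R : realType.
Implicit Types (U : set 'rV[R]_2) (X n nT nS : 'rV[R]_2 -> 'rV[R]_4)
  (u : 'rV[R]_2).

(* A point p = X u of the surface is always given by its parameter u, and
   vector fields along the surface are maps of the parameter. *)

Definition tangent X u : {vspace 'rV[R]_4} := limg (linfun ('d X u)).
Definition normal X u : {vspace 'rV[R]_4} := orthov (tangent X u).

Definition spacelike_surface U X :=
  [/\ open U, embedding_on U X &
      forall u, U u -> forall v, v \in tangent X u -> v != 0 -> spacelike v].

Definition normal_field U X n :=
  smooth_on U n /\ forall u, U u -> n u \in normal X u.

Definition future_directed_normal_frame U X nT nS :=
  [/\ normal_field U X nT, normal_field U X nS,
      forall u, U u -> mink (nT u) (nT u) = -1,
      forall u, U u -> mink (nT u) (e0 R) < 0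
    & forall u, U u ->
        let w := wedge (nT u) (partial 0 X u) (partial 1 X u) in
        nS u = (mink_norm w)^-1 *: w].

Definition tangent_proj X u : 'End('rV[R]_4) :=
  daddv_pi (tangent X u) (normal X u).

(* d_p n, for n a map of the parameter: on tangent vectors it sends 'd X u v
   to 'd n u v, and '^-1' inverts 'd X u on its image. *)
Definition surface_diff X n u : 'End('rV[R]_4) :=
  (linfun ('d n u) \o (linfun ('d X u))^-1)%VF.

Definition shape_operator X n u : 'End(subvs_of (tangent X u)) :=
  (linfun (vsproj (tangent X u)) \o (- (tangent_proj X u \o surface_diff X n u))
     \o linfun (@vsval _ _ (tangent X u)))%VF.

(* The sign of n^S is carried by the argument nS: H_l(n^T, -n^S) is
   [lightcone_mean_curvature X nT (\- nS)]. *)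
Definition lightcone_mean_curvature X nT nS u : R :=
  2^-1 * lftrace (shape_operator X (nT \+ nS) u).

Definition mean_curvature_vector X nT nS u : 'rV[R]_4 :=
  (2^-1 * lftrace (shape_operator X nT u)) *: nT u
  + (2^-1 * lftrace (shape_operator X nS u)) *: nS u.

End Surface.

(* Main.v *)
Require Import Defs.
From HB Require Import structures.
From mathcomp Require Import all_boot all_order all_algebra.
From mathcomp Require Import all_classical all_reals all_analysis.
From mathcomp Require Import ring.

Import Order.TTheory GRing.Theory Num.Theory.
Import numFieldNormedType.Exports passmx.

Local Open Scope classical_set_scope.
Local Open Scope ring_scope.

(** Put [a := 1/2 Tr S_p(n^T)] and [b := 1/2 Tr S_p(n^S)].  The shape operator
    is additive in the normal field, because the differential is, so the two
    lightcone mean curvatures at [p] are [a + b] and [a - b]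
    ([lightcone_mean_curvatureD], [lightcone_mean_curvatureB]).  The mean
    curvature vector is [a n^T + b n^S], and [n^T(u)], [n^S(u)] are
    pseudo-orthonormal of square [-1] and [1], so its square is
    [b^2 - a^2 = - (a + b) (a - b)].  A vector is isotropic exactly when its
    square vanishes, i.e. here when one of the two factors does
    ([isotropic_lincomb]).

    Orthogonality of [n^T] and [n^S] is the vanishing of a determinant with two
    equal rows.  That [n^S] has square [1], and not [0] or [-1], requires
    [w := n^T /\ X_1 /\ X_2] to be spacelike: up to sign, its square is the
    Gram determinant of the three factors ([mink_wedge]), which for the unit
    timelike normal [n^T] is [- (E G - F^2)]; and [E G - F^2 > 0] because the
    pseudo scalar product is positive definite on the tangent plane and
    [X_1], [X_2] are linearly independent ([gram_gt0]). *)

(** * The pseudo scalar product *)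

Lemma mink_lincomb (R : realType) (a b : R) (x y : 'rV[R]_4) :
  mink (a *: x + b *: y) (a *: x + b *: y) =
  a ^+ 2 * mink x x + 2 * a * b * mink x y + b ^+ 2 * mink y y.
Proof. by rewrite /mink !mxE; ring. Qed.

Lemma minkZZ (R : realType) (a : R) (x : 'rV[R]_4) :
  mink (a *: x) (a *: x) = a ^+ 2 * mink x x.
Proof. by rewrite /mink !mxE; ring. Qed.

Lemma isotropicE (R : realType) (x : 'rV[R]_4) : isotropic x <-> mink x x = 0.
Proof.
split=> [[->|[]//]|x0]; first by rewrite linear0.
by have [->|xN0] := eqVneq x 0; [left | right].
Qed.

(** The lightlike lines of the plane spanned by a pseudo-orthonormal pair are
    the two diagonals. *)
Lemma isotropic_lincomb (R : realType) (a b : R) (x y : 'rV[R]_4) :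
  mink x x = -1 -> mink y y = 1 -> mink x y = 0 ->
  a + b = 0 \/ a - b = 0 <-> isotropic (a *: x + b *: y).
Proof.
move=> xx yy xy; apply: iff_trans (iff_sym (isotropicE _ _)).
have -> : mink (a *: x + b *: y) (a *: x + b *: y) = - ((a + b) * (a - b)).
  by rewrite mink_lincomb xx yy xy; ring.
split=> [[->|->]|/eqP]; rewrite ?mul0r ?mulr0 ?oppr0 //.
by rewrite oppr_eq0 mulf_eq0 => /orP[]/eqP; [left | right].
Qed.

Lemma mink_normalize (R : realType) (w : 'rV[R]_4) : 0 < mink w w ->
  mink ((mink_norm w)^-1 *: w) ((mink_norm w)^-1 *: w) = 1.
Proof.
move=> ww; rewrite minkZZ /mink_norm gtr0_norm //.
by rewrite exprVn sqr_sqrtr ?ltW // mulVf // lt0r_neq0.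
Qed.

(** * The wedge product *)

Lemma det4E (R : realType) (x y z t : 'rV[R]_4) :
  let minor i j k :=
    y 0 i * (z 0 j * t 0 k - z 0 k * t 0 j)
    - y 0 j * (z 0 i * t 0 k - z 0 k * t 0 i)
    + y 0 k * (z 0 i * t 0 j - z 0 j * t 0 i) in
  det4 x y z t = x 0 0 * minor 1 2 3 - x 0 1 * minor 0 2 3
    + x 0 2 * minor 0 1 3 - x 0 3 * minor 0 1 2.
Proof.
move=> minor; rewrite /det4.
(* With the columns numbered by nat, the iterated lifts of the expansion
   compute to numerals. *)
pose f (v : 'rV[R]_4) k : R := v 0 (inord k).
have fE (v : 'rV[R]_4) i : v 0 i = f v i by rewrite /f inord_val.
do 3 rewrite !(expand_det_row _ ord0) !big_ord_recl !big_ord0 /cofactor.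
rewrite !det_mx11 !mxE !fE /minor !fE /= /bump !leq0n /= !addn0 !addn1 /=.
ring.
Qed.

(** The square of a wedge product is minus the Gram determinant of its factors;
    the sign is that of the determinant of the pseudo scalar product. *)
Lemma mink_wedge (R : realType) (x y z : 'rV[R]_4) :
  mink (wedge x y z) (wedge x y z) =
  - (mink x x * (mink y y * mink z z - mink y z ^+ 2)
     - mink x y * (mink x y * mink z z - mink y z * mink x z)
     + mink x z * (mink x y * mink y z - mink y y * mink x z)).
Proof.
(* The coordinates of the wedge are read off by pairing it with the canonical
   basis; the first one changes sign. *)
pose m v := det4 v x y z.
have w0 : wedge x y z 0 0 = - m (delta_mx 0 0).
  by rewrite /m -wedgeP /mink !mxE /=; ring.
have w1 : wedge x y z 0 1 = m (delta_mx 0 1).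
  by rewrite /m -wedgeP /mink !mxE /=; ring.
have w2 : wedge x y z 0 2 = m (delta_mx 0 2).
  by rewrite /m -wedgeP /mink !mxE /=; ring.
have w3 : wedge x y z 0 3 = m (delta_mx 0 3).
  by rewrite /m -wedgeP /mink !mxE /=; ring.
rewrite {1}/mink w0 w1 w2 w3 /m !det4E !mxE /= /mink.
ring.
Qed.

Lemma mink_wedge_orth (R : realType) (x y z : 'rV[R]_4) :
  mink x y = 0 -> mink x z = 0 ->
  mink (wedge x y z) (wedge x y z) =
  - mink x x * (mink y y * mink z z - mink y z ^+ 2).
Proof. by move=> xy xz; rewrite mink_wedge xy xz; ring. Qed.

(** Strict Cauchy-Schwarz inequality on a spacelike subspace: the difference is
    [mink y y] times the square of the component of [z] orthogonal to [y]. *)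
Lemma gram_gt0 (R : realType) (V : {vspace 'rV[R]_4}) (y z : 'rV[R]_4) :
  (forall v, v \in V -> v != 0 -> spacelike v) ->
  y \in V -> z \in V -> y != 0 ->
  (forall a, z != a *: y) ->
  0 < mink y y * mink z z - mink y z ^+ 2.
Proof.
move=> posV yV zV yN0 zNy.
have [_ yy] := posV y yV yN0.
pose a := mink y z / mink y y.
have [] := posV (z - a *: y).
- by rewrite rpredB // rpredZ.
- by rewrite subr_eq0.
move=> _ pos.
have -> : mink y y * mink z z - mink y z ^+ 2 =
  mink y y * mink (z - a *: y) (z - a *: y).
  have -> : z - a *: y = 1 *: z + (- a) *: y by rewrite scale1r scaleNr.
  rewrite mink_lincomb (minkC z y) /a; field; exact: lt0r_neq0.
exact: mulr_gt0.
Qed.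

(** * Linearity of the shape operator in the normal field *)

Lemma lftraceD (K : fieldType) (vT : vectType K) (f g : 'End(vT)) :
  lftrace (f + g) = lftrace f + lftrace g.
Proof. by rewrite /lftrace (linearD (mxof _ _)) linearD. Qed.

Lemma lftraceN (K : fieldType) (vT : vectType K) (f : 'End(vT)) :
  lftrace (- f) = - lftrace f.
Proof. by rewrite /lftrace (linearN (mxof _ _)) raddfN. Qed.

(** The linearity hypothesis is a proposition rather than a linear structure on
    [f]: the differential is linear for the module structures underlying the
    normed spaces, and those of the vector spaces of matrices are only
    convertible to them. *)
Lemma linfunE (K : fieldType) (aT rT : vectType K) (f : aT -> rT) :
  linear f -> linfun f =1 f.
Proof.
move=> linf v.
pose g := HB.pack_for {linear aT -> rT} f (GRing.isLinear.Build _ _ _ _ f linf).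
exact: (lfunE g).
Qed.

Lemma linfunD (K : fieldType) (aT rT : vectType K) (f g : aT -> rT) :
  linear f -> linear g -> linfun (f \+ g) = linfun f + linfun g.
Proof.
move=> linf ling; apply/lfunP => v; rewrite add_lfunE !linfunE //.
by move=> a x y /=; rewrite linf ling scalerDr addrACA.
Qed.

Lemma linfunN (K : fieldType) (aT rT : vectType K) (f : aT -> rT) :
  linear f -> linfun (\- f) = - linfun f.
Proof.
move=> linf; apply/lfunP => v; rewrite opp_lfunE !linfunE //.
by move=> a x y /=; rewrite linf opprD scalerN.
Qed.

Section Differential.
Variables (R : realType) (f g : 'rV[R]_2 -> 'rV[R]_4) (u : 'rV[R]_2).

Lemma linfun_diffE v : linfun ('d f u) v = 'd f u v.
Proof. by apply: linfunE; exact: linearP. Qed.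

Lemma linfun_diffD : differentiable f u -> differentiable g u ->
  linfun ('d (f \+ g) u) = linfun ('d f u) + linfun ('d g u).
Proof.
move=> df dg; apply: (etrans (congr1 linfun (diffD df dg))).
by apply: linfunD; exact: linearP.
Qed.

Lemma linfun_diffN : differentiable f u ->
  linfun ('d (\- f) u) = - linfun ('d f u).
Proof.
move=> df; apply: (etrans (congr1 linfun (diffN df))).
by apply: linfunN; exact: linearP.
Qed.

End Differential.

Section ShapeOperator.
Variables (R : realType) (X n m : 'rV[R]_2 -> 'rV[R]_4) (u : 'rV[R]_2).

Lemma surface_diffD : differentiable n u -> differentiable m u ->
  surface_diff X (n \+ m) u = surface_diff X n u + surface_diff X m u.
Proof.
move=> dn dm.
pose precomp (h : 'Hom('rV[R]_2, 'rV[R]_4)) :=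
  (h \o (linfun ('d X u))^-1)%VF.
apply: etrans (congr1 precomp (linfun_diffD _ _ _ _ dn dm)) _.
exact: comp_lfunDl.
Qed.

Lemma surface_diffN : differentiable n u ->
  surface_diff X (\- n) u = - surface_diff X n u.
Proof.
move=> dn.
pose precomp (h : 'Hom('rV[R]_2, 'rV[R]_4)) :=
  (h \o (linfun ('d X u))^-1)%VF.
apply: etrans (congr1 precomp (linfun_diffN _ _ _ dn)) _.
exact: comp_lfunNl.
Qed.

Lemma shape_operatorD : differentiable n u -> differentiable m u ->
  shape_operator X (n \+ m) u = shape_operator X n u + shape_operator X m u.
Proof.
move=> dn dm; rewrite /shape_operator surface_diffD //.
by rewrite comp_lfunDr opprD comp_lfunDr comp_lfunDl.
Qed.

Lemma shape_operatorN : differentiable n u ->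
  shape_operator X (\- n) u = - shape_operator X n u.
Proof.
move=> dn; rewrite /shape_operator surface_diffN //.
by rewrite comp_lfunNr comp_lfunNr comp_lfunNl.
Qed.

End ShapeOperator.

(** * The normal frame *)

(** The wedge of a timelike normal vector with the coordinate tangent vectors
    is spacelike, so that normalizing it gives a vector of square [1]. *)
Lemma mink_normal_wedge_gt0 (R : realType) (U : set 'rV[R]_2)
    (X : 'rV[R]_2 -> 'rV[R]_4) (u : 'rV[R]_2) (n : 'rV[R]_4) :
  spacelike_surface U X -> U u -> n \in normal X u -> mink n n < 0 ->
  0 < mink (wedge n (partial 0 X u) (partial 1 X u))
           (wedge n (partial 0 X u) (partial 1 X u)).
Proof.
move=> [_ [smX injX _] posX] Uu nN nn.
have dX : differentiable X u := smX [::] u Uu.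
have pE i : partial i X u = 'd X u (delta_mx 0 i) by rewrite /partial deriveE.
have dT v : 'd X u v \in tangent X u.
  by rewrite -linfun_diffE memv_img ?memvf.
have orth i : mink n (partial i X u) = 0.
  rewrite minkC pE.
  exact: (elimT (Defs.orthovP _ _) nN) (dT _).
rewrite mink_wedge_orth // mulr_gt0 ?oppr_gt0 //.
apply: (gram_gt0 _ _ _ _ (posX u Uu)); rewrite ?pE ?dT //.
- apply/negP => /eqP; rewrite -[RHS](linear0 ('d X u)) => /(injX u Uu).
  by move=> /matrixP/(_ 0 0); rewrite !mxE /= => /eqP; rewrite oner_eq0.
- move=> a; apply/negP => /eqP; rewrite -linearZ => /(injX u Uu).
  by move=> /matrixP/(_ 0 1); rewrite !mxE /= mulr0 => /eqP; rewrite oner_eq0.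
Qed.

(** * Lightcone mean curvatures and the mean curvature vector *)

Definition mean_curvature_along (R : realType)
    (X n : 'rV[R]_2 -> 'rV[R]_4) (u : 'rV[R]_2) : R :=
  2^-1 * lftrace (shape_operator X n u).

Lemma lightcone_mean_curvatureD (R : realType)
    (X nT nS : 'rV[R]_2 -> 'rV[R]_4) (u : 'rV[R]_2) :
  differentiable nT u -> differentiable nS u ->
  lightcone_mean_curvature X nT nS u =
  mean_curvature_along R X nT u + mean_curvature_along R X nS u.
Proof.
move=> dT dS.
by rewrite /lightcone_mean_curvature shape_operatorD // lftraceD mulrDr.
Qed.

Lemma lightcone_mean_curvatureB (R : realType)
    (X nT nS : 'rV[R]_2 -> 'rV[R]_4) (u : 'rV[R]_2) :
  differentiable nT u -> differentiable nS u ->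
  lightcone_mean_curvature X nT (\- nS) u =
  mean_curvature_along R X nT u - mean_curvature_along R X nS u.
Proof.
move=> dT dS; rewrite lightcone_mean_curvatureD //; last exact: differentiableN.
by rewrite /mean_curvature_along shape_operatorN // lftraceN mulrN.
Qed.

Theorem proposition3p2 (R : realType) (U : set 'rV[R]_2)
    (X nT nS : 'rV[R]_2 -> 'rV[R]_4) (u : 'rV[R]_2)
    (surfaceX : spacelike_surface U X)
    (frame : future_directed_normal_frame U X nT nS)
    (Uu : U u) :
  lightcone_mean_curvature X nT nS u = 0 \/
  lightcone_mean_curvature X nT (\- nS) u = 0
  <-> isotropic (mean_curvature_vector X nT nS u).
Proof.
have [[smT nTN] [smS _] nTT _ /(_ u Uu) /= nSE] := frame.
have dT : differentiable nT u := smT [::] u Uu.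
have dS : differentiable nS u := smS [::] u Uu.
have SS : mink (nS u) (nS u) = 1.
  have T_lt0 : mink (nT u) (nT u) < 0 by rewrite nTT // ltrN10.
  rewrite nSE; apply: mink_normalize.
  exact: mink_normal_wedge_gt0 surfaceX Uu (nTN u Uu) T_lt0.
have TS : mink (nT u) (nS u) = 0.
  rewrite nSE linearZ /= wedgeP /det4.
  rewrite (determinant_alternate (i1 := 0) (i2 := 1)) //; first exact: scaler0.
  by move=> j; rewrite !mxE.
rewrite lightcone_mean_curvatureD // lightcone_mean_curvatureB //.
exact: isotropic_lincomb (nTT u Uu) SS TS.
Qed.
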